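(* There is an absolute constant $C>0$ such that for all positive integers $k\ge 2$ and $n\ge k$, $$c^{\mathrm{CD}}_k(n)\ \ge\ C\sqrt{n}.$$
   Context: There is a finite set $G$ of items (goods) and $n$ agents. Each agent $a$ has a utility function $u_a$ on subsets of $G$ that is monotone and additive: $u_a(S)=\sum_{g\in S}u_a(g)$ for all $S\subseteq G$, with $u_a(g)\ge 0$ for all $g\in G$. An allocation $A=(A_1,\dots,A_k)$ is a partition of $G$ into $k$ (possibly empty) bundles. For a nonnegative integer $c$, an allocation $A$ is a consensus $1/k$-division up to $c$ goods (CD$_k c$) if for all $i,i'\in\{1,\dots,k\}$ and every agent $a$ there is a set $B\subseteq G$ with $|B|\le c$ such that $u_a(A_i)\ge u_a(A_{i'}\setminus B)$. $c^{\mathrm{CD}}_k(n)$ is the smallest $c$ such that, for every finite set $G$ of goods and every choice of monotone additive utilities of the $n$ agents, a CD$_k c$ allocation exists. *)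

(* Defs.v *)
From mathcomp Require Import all_boot all_order all_algebra.
From mathcomp Require Import boolp classical_sets reals constructive_ereal ereal.

Set Implicit Arguments.
Unset Strict Implicit.
Unset Printing Implicit Defensive.

Import Order.TTheory GRing.Theory Num.Theory.
Local Open Scope ring_scope.

Definition monotone_additive (R : realType) (G : finType) (u : {set G} -> R) :
    Prop :=
  (forall S : {set G}, u S = \sum_(g in S) u [set g]%SET) /\
  (forall g : G, 0 <= u [set g]%SET).

(* Bundles are indexed by 'I_k and may be empty, so finset.partition, which
   excludes set0, does not apply. *)
Definition allocation (G : finType) (k : nat) (A : 'I_k -> {set G}) : Prop :=
  (forall i j : 'I_k, i != j -> [disjoint A i & A j]) /\
  \bigcup_(i < k) A i = [set: G]%SET.

(* [B] may depend on the two bundles and on the agent. *)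
Definition CD_upto (R : realType) (G : finType) (n k c : nat)
    (u : 'I_n -> {set G} -> R) (A : 'I_k -> {set G}) : Prop :=
  allocation A /\
  forall (i i' : 'I_k) (a : 'I_n),
    exists B : {set G}, (#|B| <= c)%N /\ u a (A i' :\: B) <= u a (A i).

Definition CD_guaranteed (R : realType) (k n c : nat) : Prop :=
  forall (G : finType) (u : 'I_n -> {set G} -> R),
    (forall a : 'I_n, monotone_additive (u a)) ->
    exists A : 'I_k -> {set G}, CD_upto c u A.

(* A nonempty set of naturals has a minimum, so this infimum is the smallest
   guaranteed [c] (see [cCD_minP]); it would be +oo if no [c] were guaranteed. *)
Definition cCD (R : realType) (k n : nat) : \bar R :=
  ereal_inf [set (c%:R)%:E | c in [set c : nat | CD_guaranteed R k n c]]%classic.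

Lemma cCD_minP (R : realType) (k n c : nat) :
  cCD R k n = (c%:R)%:E <->
  CD_guaranteed R k n c /\
  (forall c' : nat, CD_guaranteed R k n c' -> (c <= c')%N).
Proof.
have lb c' : CD_guaranteed R k n c' -> (cCD R k n <= (c'%:R)%:E)%E.
  by move=> h; apply: ereal_inf_lbound; exists c'.
split=> [e|[h m]].
  have m c' : CD_guaranteed R k n c' -> (c <= c')%N.
    by move=> /lb; rewrite e lee_fin ler_nat.
  split=> //; apply: contrapT => nh.
  have : ((c.+1%:R)%:E <= cCD R k n)%E.
    apply: le_ereal_inf_tmp => _ [c' h' <-]; rewrite lee_fin ler_nat ltn_neqAle m //.
    by rewrite andbT; apply/eqP => ec; apply: nh; rewrite ec.
  by rewrite e lee_fin ler_nat ltnn.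
apply/eqP; rewrite eq_le lb //=; apply: le_ereal_inf_tmp => _ [c' h' <-].
by rewrite lee_fin ler_nat m.
Qed.

(* Main.v *)
Require Import Defs.
From mathcomp Require Import all_boot all_order all_algebra.
From mathcomp Require Import boolp classical_sets reals constructive_ereal ereal.
From mathcomp Require Import ring lra zify.

Import Order.TTheory GRing.Theory Num.Theory.
Local Open Scope ring_scope.

(** Let [N] be a power of 2 with [N <= n < 2 N], and let [H] be the Sylvester
    Hadamard matrix of order [N]. Take [N] types of goods with [h = k./2]
    identical copies each; the agent of a given row of [H] values at 1 the
    goods of the types where that row is [+1], and the others at 0. A bundle
    receives an integer number of goods of each type, whereas the average over
    the bundles is [h / k], which lies in [[1/3, 1/2]]; so the bundle is off
    by at least 1/3 in each of the [N] coordinates. As [H] multiplies the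
    Euclidean norm by [sqrt N], some row of [H] sees a deviation of at least
    [sqrt N / 3] from the average, hence also from some other bundle. A row of
    [H] is twice the valuation of its agent minus the all-ones row, which is
    itself a valuation; passing from [H] to the agents thus costs a factor 3,
    whence [sqrt N <= 9 c]. *)

Lemma sum_prod_type (V : nmodType) (I J : finType) (F : I * J -> V) :
  \sum_p F p = \sum_i \sum_j F (i, j).
Proof. by rewrite pair_bigA; apply: eq_bigr => -[]. Qed.

(** Sylvester doubling: the signs of [h] form a matrix that grows from [H] to the blocks [H, H] over
    [H, -H], and [(u - v)^2 + (u + v)^2 = 2 (u^2 + v^2)] doubles the factor. Row [o] is all ones. *)
Lemma sylvester_hadamard (t : nat) :
  exists (T : finType) (h : T -> T -> bool) (o : T),
    [/\ #|T| = (2 ^ t)%N, (forall b, h o b = false) &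
      forall (R : comNzRingType) (y : T -> R),
        \sum_a (\sum_b (-1) ^+ h a b * y b) ^+ 2
          = (2 ^ t)%:R * \sum_b y b ^+ 2].
Proof.
elim: t => [|t [T [h [o [cardT ho parseval]]]]].
  exists unit, (fun _ _ => false), tt; split=> //; first by rewrite card_unit.
  move=> R y; rewrite mul1r.
  by apply: eq_bigr => -[] _; rewrite (big_pred1 tt) ?mul1r // => -[].
exists (T * bool)%type, (fun a b => h a.1 b.1 (+) (a.2 && b.2)), (o, false).
split=> [|b|R y].
- by rewrite card_prod cardT card_bool expnSr.
- by rewrite /= ho.
have sum_pair (F : T * bool -> R) :
    \sum_p F p = \sum_a F (a, true) + \sum_a F (a, false).
  rewrite sum_prod_type -big_split /=.
  by apply: eq_bigr => a _; rewrite big_bool.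
rewrite !sum_pair /=.
under eq_bigr => a _.
  rewrite sum_pair /= -big_split /=.
  under eq_bigr => b _ do
    rewrite addbT addbF signrN mulNr addrC -mulrN -mulrDr.
  over.
rewrite parseval.
under [X in _ + X]eq_bigr => a _.
  rewrite sum_pair /= -big_split /=.
  under eq_bigr => b _ do rewrite addbF -mulrDr.
  over.
rewrite parseval -mulrDr -big_split /= expnSr natrM -mulrA; congr (_ * _).
rewrite -big_split mulr_sumr; apply: eq_bigr => b _ /=; ring.
Qed.

(** Each good is worth at most 1, so removing [B] lowers a value by at most [c]. *)
Lemma CD_upto_le {R : realType} {G : finType} {n k c : nat}
    {w : 'I_n -> G -> bool} {A : 'I_k -> {set G}} :
  CD_upto c (fun a S => \sum_(g in S) (w a g)%:R : R) A ->
  forall i j a,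
    `|\sum_(g in A i) (w a g)%:R - \sum_(g in A j) (w a g)%:R : R| <= c%:R.
Proof.
move=> [_ cd].
have le_cd i j a :
    \sum_(g in A j) (w a g)%:R - \sum_(g in A i) (w a g)%:R <= c%:R :> R.
  have [B [cardB]] := cd i j a; rewrite [X in X - _](big_setID B) /= => leB.
  suff : \sum_(g in A j :&: B) (w a g)%:R <= c%:R :> R by lra.
  apply: le_trans (_ : #|B|%:R <= _); last by rewrite ler_nat.
  rewrite -sum1_card natr_sum [leRHS](big_setID (A j)) /= finset.setIC.
  apply: ler_wpDr; first exact: sumr_ge0.
  by apply: ler_sum => g _; rewrite ler_nat leq_b1.
by move=> i j a; rewrite ler_norml le_cd andbT lerNl opprB le_cd.
Qed.

Lemma sum_allocation (V : nmodType) (G : finType) (k : nat)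
    (A : 'I_k -> {set G}) (F : G -> V) :
  allocation A -> \sum_i \sum_(g in A i) F g = \sum_g F g.
Proof.
move=> [disjA coverA].
rewrite -partition_disjoint_bigcup // coverA.
by apply: eq_bigl => g; rewrite inE.
Qed.

Theorem corollary4p1 (R : realType) :
  exists C : R, 0 < C /\
    forall k n : nat, (2 <= k)%N -> (k <= n)%N ->
      ((C * Num.sqrt n%:R)%:E <= cCD R k n)%E.
Proof.
(* The end gives [N <= 81 c^2], so [n < 2 N] yields [n <= 162 c^2 <= (13 c)^2]. *)
exists 13^-1; split=> [|k n k_ge2 le_kn]; first by rewrite invr_gt0.
apply: le_ereal_inf_tmp => _ [c cd <-]; rewrite lee_fin.
rewrite mulrC ler_pdivrMr //.
suff le_n : n%:R <= (c%:R * 13) ^+ 2 :> R.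
  by rewrite -(ger0_norm (_ : 0 <= c%:R * 13)) ?mulr_ge0 // -sqrtr_sqr ler_wsqrtr.
have n_gt0 : (0 < n)%N by lia.
pose t := trunc_log 2 n.
have le_tn : (2 ^ t <= n)%N by exact: trunc_logP.
have lt_nt : (n < 2 ^ t.+1)%N by exact: trunc_log_ltn.
have [T [h [o [cardT ho parseval]]]] := sylvester_hadamard t.
pose q := k./2.
have [q_gt0 le_2q le_3q] : [/\ (0 < q)%N, (q + q <= k)%N & (k <= 3 * q)%N].
  by rewrite /q; split; lia.
(* Agents beyond the first [N] repeat the row [o]. *)
pose row (a : 'I_n) := nth o (enum T) a.
have row_onto b : exists a, row a = b.
  have lt_b : (index b (enum T) < n)%N.
    by apply: leq_trans le_tn; rewrite -cardT cardE index_mem mem_enum.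
  by exists (Ordinal lt_b); rewrite /row nth_index ?mem_enum.
pose w a (g : T * 'I_q) := ~~ h (row a) g.1.
have [|A cdA] := cd _ (fun a S => \sum_(g in S) (w a g)%:R).
  move=> a; split=> [S|g]; last by rewrite big_set1.
  by apply: eq_bigr => g _; rewrite big_set1.
have allocA := proj1 cdA.
pose d i a : R := \sum_(g in A i) (w a g)%:R.
have dev i j a : `|d i a - d j a| <= c%:R by exact: CD_upto_le cdA i j a.
have k_gt0 : (0 < k)%N by lia.
pose i0 := Ordinal k_gt0.
pose H a (g : T * 'I_q) : R := (-1) ^+ h a g.1.
have devH i j a :
    `|\sum_(g in A i) H a g - \sum_(g in A j) H a g| <= 3 * c%:R.
  have [r ra] := row_onto a; have [r0 ro] := row_onto o.
  have HE l : \sum_(g in A l) H a g = 2 * d l r - d l r0.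
    rewrite /d mulr_sumr -sumrB; apply: eq_bigr => g _.
    by rewrite /H /w ra ro ho; case: (h _ _) => /=; ring.
  have := dev i j r; have := dev i j r0.
  rewrite !HE !ler_norml => /andP[? ?] /andP[? ?]; apply/andP; split; lra.
pose x (b : T) := (\sum_(g in A i0 | g.1 == b) 1)%N.
(* This is [k] times the deviation of bundle [i0] from the average [q / k], which keeps it an
   integer. *)
pose y (b : T) : R := k%:R * (x b)%:R - q%:R.
have y_ge b : q%:R ^+ 2 <= y b ^+ 2.
  rewrite /y -natrM.
  (* Either [y b = - q], or [y b >= k - q >= q]. *)
  have [x0|x_gt0] := posnP (x b); first by rewrite x0 muln0 sub0r sqrrN.
  rewrite ler_sqr ?nnegrE // ?subr_ge0 ?lerBrDr -?natrD ler_nat; nia.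
have Hy_le a : (\sum_b (-1) ^+ h a b * y b) ^+ 2 <= (k%:R * (3 * c%:R)) ^+ 2.
  (* Since the bundles partition the goods, [k] times the value of [A i0] minus the total value is a
     sum of [k] differences, each bounded by [devH]. *)
  have HyE : \sum_b (-1) ^+ h a b * y b
      = \sum_j (\sum_(g in A i0) H a g - \sum_(g in A j) H a g).
    rewrite sumrB sumr_const card_ord sum_allocation //.
    under eq_bigr => b _ do rewrite mulrBr.
    rewrite sumrB; congr (_ - _).
      rewrite -[RHS]mulr_natl (partition_big fst predT) //= mulr_sumr.
      apply: eq_bigr => b _; rewrite mulrCA /x natr_sum mulr_sumr.
      by congr (_ * _); apply: eq_bigr => g /andP[_ /eqP <-]; rewrite mulr1.
    rewrite sum_prod_type; apply: eq_bigr => b _.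
    by rewrite /H /= sumr_const card_ord mulr_natr.
  rewrite -ler_sqrt ?sqr_ge0 // !sqrtr_sqr HyE.
  rewrite [leRHS]ger0_norm ?mulr_ge0 //.
  apply: le_trans (ler_norm_sum _ _ _) _.
  rewrite mulr_natl -[k in leRHS]card_ord -sumr_const.
  by apply: ler_sum => j _; apply: devH.
have : \sum_a (\sum_b (-1) ^+ h a b * y b) ^+ 2
    <= \sum_(a : T) (k%:R * (3 * c%:R)) ^+ 2 by apply: ler_sum => a _; apply: Hy_le.
rewrite parseval sumr_const cardT -[leRHS]mulr_natl ler_pM2l ?ltr0n ?expn_gt0 //.
have : \sum_(b : T) q%:R ^+ 2 <= \sum_b y b ^+ 2 by apply: ler_sum.
rewrite sumr_const cardT => /le_trans le_q /le_q.
have -> : (k%:R * (3 * c%:R)) ^+ 2 = ((k * (3 * c)) ^ 2)%:R :> R.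
  by rewrite natrX !natrM.
have -> : (c%:R * 13) ^+ 2 = ((c * 13) ^ 2)%:R :> R by rewrite natrX natrM.
rewrite -[q%:R ^+ 2 *+ _]mulr_natl -natrX -natrM !ler_nat.
rewrite expnS in lt_nt.
move: (2 ^ t)%N lt_nt => N lt_nN leN.
(* Here [k <= 3 q] replaces [k] by [q], which then cancels. *)
have : (N * q ^ 2 <= 81 * c ^ 2 * q ^ 2)%N.
  apply: leq_trans leN _.
  have : (k ^ 2 <= (3 * q) ^ 2)%N by rewrite leq_sqr.
  rewrite !expnMn; nia.
rewrite leq_pmul2r ?expn_gt0 ?q_gt0 //; lia.
Qed.
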